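(* Let $M\ge 2$ be even, let $\boldsymbol u,\boldsymbol\alpha\in\mathbb{R}^{2\times M}$, and let $\boldsymbol\mu=\boldsymbol u\boldsymbol\psi$ and $\mathbf C^*=\boldsymbol\alpha\boldsymbol\psi$, where both $\boldsymbol\mu$ and $\mathbf C^*$ have unit norm in $\mathcal H$. Then the optimization problem $$\min_{(\theta,\delta)\in[0,2\pi]\times[0,1]}\ \left\|\mathbf O_\theta\,\boldsymbol\mu\circ\gamma_\delta-\mathbf C^*\right\|_{\mathcal H}^2$$ is equivalent to the optimization problem $$\min_{(\theta,\delta)\in[0,2\pi]\times[0,1]}\ \left\|\mathbf O_\theta\,\boldsymbol u\,\boldsymbol\beta(-\delta)-\boldsymbol\alpha\right\|_F^2.$$
   Context: $\mathcal H=L^2([0,1],\mathbb R)\times L^2([0,1],\mathbb R)$ with inner product $\langle \boldsymbol f,\boldsymbol g\rangle_{\mathcal H}=\int_0^1\{f_1(t)g_1(t)+f_2(t)g_2(t)\}\,dt$ and induced norm $\|\cdot\|_{\mathcal H}$. $\|\cdot\|_F$ is the Frobenius norm. For $\delta\in[0,1]$, $\gamma_\delta:[0,1]\to[0,1]$ is $\gamma_\delta(t)=\mathrm{mod}(t-\delta,1)$, where $\mathrm{mod}(x,1)=x-\lfloor x\rfloor$. For $\theta\in\mathbb R$, $\mathbf O_\theta=\begin{pmatrix}\cos\theta&-\sin\theta\\ \sin\theta&\cos\theta\end{pmatrix}$. Fourier basis: for $k=1,\dots,M$, $\psi_k(t)=\sqrt2\sin((k+1)\pi t)$ if $k$ is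 odd and $\psi_k(t)=\sqrt2\cos(k\pi t)$ if $k$ is even, $t\in[0,1]$; $\boldsymbol\psi=(\psi_1,\dots,\psi_M)^\top$. For $\boldsymbol a\in\mathbb R^{2\times M}$, $\boldsymbol a\boldsymbol\psi$ denotes the element $t\mapsto \boldsymbol a\boldsymbol\psi(t)$ of $\mathcal H$. The composition $\boldsymbol f\circ\gamma_\delta$ is taken coordinate-wise, and $\mathbf O_\theta$ acts pointwise. For $s\in\mathbb R$, $\boldsymbol\beta(s)\in\mathbb R^{M\times M}$ is the block-diagonal matrix with successive $2\times2$ diagonal blocks $\mathbf O_{2\pi s},\mathbf O_{4\pi s},\dots,\mathbf O_{M\pi s}$ and zeros elsewhere. *)

(* Defs.v *)
From mathcomp Require Import all_boot all_order all_algebra.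
From mathcomp Require Import all_classical all_reals all_analysis.
From mathcomp Require Import measurable_realfun.
Import Order.TTheory GRing.Theory Num.Theory numFieldNormedType.Exports.

Set Implicit Arguments.
Unset Strict Implicit.
Unset Printing Implicit Defensive.

Local Open Scope classical_set_scope.
Local Open Scope ring_scope.

Section Definitions.
Variable R : realType.

Definition unit_interval : set R := `[0, 1].

(* Elements of H = L^2([0,1],R) x L^2([0,1],R) are given by representatives
   f : R -> 'cV[R]_2, whose rows are f_1 and f_2; only the values on [0,1]
   matter. *)
Definition inH (f : R -> 'cV[R]_2) : Prop :=
  forall i : 'I_2, measurable_fun unit_interval (fun t => f t i 0) /\
    (@lebesgue_measure R).-integrable unit_interval (fun t => ((f t i 0) ^+ 2)%:E).

Definition dotH (f g : R -> 'cV[R]_2) : R :=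
  \int[@lebesgue_measure R]_(t in unit_interval)
    (f t 0 0 * g t 0 0 + f t 1 0 * g t 1 0).

Definition normH (f : R -> 'cV[R]_2) : R := Num.sqrt (dotH f f).

Definition frobenius (m n : nat) (A : 'M[R]_(m, n)) : R :=
  Num.sqrt (\sum_i \sum_j A i j ^+ 2).

Definition gamma (delta t : R) : R := (t - delta) - (Num.floor (t - delta))%:~R.

Definition rot (theta : R) : 'M[R]_2 :=
  \matrix_(i, j) if i == j then cos theta
                 else if i == 0 then - sin theta else sin theta.

(* Meaningful for k >= 1. *)
Definition fourier_fun (k : nat) (t : R) : R :=
  if odd k then Num.sqrt 2 * sin (k.+1%:R * pi * t)
  else Num.sqrt 2 * cos (k%:R * pi * t).

(* Indices in 'I_M start at 0, hence the shift. *)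
Definition psi (M : nat) (t : R) : 'cV[R]_M := \col_i fourier_fun i.+1 t.

Definition fourier_series (M : nat) (a : 'M[R]_(2, M)) : R -> 'cV[R]_2 :=
  fun t => a *m psi M t.

(* For M even, block number b (counted from 0) occupies rows and columns
   b.*2 and b.*2.+1, and is rot (2 * (b + 1) * pi * s). *)
Definition beta (M : nat) (s : R) : 'M[R]_M :=
  \matrix_(i, j)
    if i./2 == j./2 then
      rot ((i./2).+1.*2%:R * pi * s) (inord (odd i)) (inord (odd j))
    else 0.

Definition feasible : set (R * R) := `[0, 2 * pi] `*` unit_interval.

Definition objH (mu C : R -> 'cV[R]_2) (p : R * R) : R :=
  normH (fun t => rot p.1 *m mu (gamma p.2 t) - C t) ^+ 2.

Definition objF (M : nat) (u alpha : 'M[R]_(2, M)) (p : R * R) : R :=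
  frobenius (rot p.1 *m u *m beta M (- p.2) - alpha) ^+ 2.

Definition argmin (T : Type) (D : set T) (f : T -> R) : set T :=
  [set x | D x /\ forall y, D y -> f x <= f y].

Definition is_min (T : Type) (D : set T) (f : T -> R) (m : R) : Prop :=
  exists2 x, argmin D f x & f x = m.

(* The problems  min_D f  and  min_D g  are equivalent through the change of
   variables h : D -> D. *)
Definition equivalent_via (T : Type) (D : set T) (h : T -> T) (f g : T -> R) :=
  [/\ set_bij D D h,
      (forall x, D x -> f x = g (h x)),
      h @` argmin D f = argmin D g &
      exists m, is_min D f m /\ is_min D g m].

(* Reversal of the circular shift: beta (- (1 - delta)) = beta delta, and
   psi \o gamma delta = beta delta *m psi.  The identity is not a valid change
   of variables between the two objectives: for M = 2 and
   u = alpha = (sqrt 2)^-1 *: 1, the point (pi / 2, 3 / 4) minimises only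
   objH and (pi / 2, 1 / 4) only objF. *)
Definition reverse_shift (p : R * R) : R * R := (p.1, 1 - p.2).

End Definitions.

(* All functions whose norm is taken in the two problems belong to H, so that
   the real-valued integral in dotH is never a default value. *)
Section Membership.
Variable R : realType.
Implicit Types f g : R -> 'cV[R]_2.

Let tame (h : R -> R) :=
  measurable_fun setT h /\ exists B, forall t, `|h t| <= B.

Let measurable_unit : measurable (@unit_interval R).
Proof. exact: measurable_itv. Qed.

Let tame_inH f : (forall i, tame (fun t => f t i 0)) -> inH f.
Proof.
move=> tf i; have [mf [B fB]] := tf i; split.
  exact: measurable_funTS.
have mf2 : measurable_fun (@unit_interval R) (fun t : R => f t i 0 ^+ 2).
  by apply: measurable_funTS; exact: measurable_funX.
apply: (@measurable_bounded_integrable _ _ _ lebesgue_measure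
  (fun t => f t i 0 ^+ 2)) => //.
- have := lebesgue_measure_itv (`[0, 1] : interval R); rewrite /= => ->.
  by rewrite lte_fin ltr01 -EFinB ltry.
- exists (B ^+ 2); split; first exact: num_real.
  move=> x /ltW Bx t _; apply: le_trans Bx.
  by rewrite /= normrX lerXn2r ?nnegrE // (le_trans _ (fB t)).
Qed.

Let tame_mulmx (n m : nat) (A : 'M[R]_(n, m)) (F : R -> 'cV[R]_m) :
  (forall j, tame (fun t => F t j 0)) ->
  forall i, tame (fun t => (A *m F t) i 0).
Proof.
move=> tF i; split.
  under eq_fun do rewrite mxE; apply: measurable_sum => j.
  by apply: measurable_funM => //; case: (tF j).
have /choice[B FB] : forall j, exists B, forall t, `|F t j 0| <= B.
  by move=> j; case: (tF j).
exists (\sum_j `|A i j| * B j) => t; rewrite mxE.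
apply: le_trans (ler_norm_sum _ _ _) _; apply: ler_sum => j _.
by rewrite normrM ler_wpM2l.
Qed.

Let measurable_gamma (delta : R) : measurable_fun setT (gamma delta).
Proof.
apply: measurable_funB; first exact: measurable_funB.
apply: nondecreasing_measurable => // x y xy.
by rewrite ler_int le_floor // lerD2r.
Qed.

Let tame_psi (M : nat) (h : R -> R) : measurable_fun setT h ->
  forall j, tame (fun t => psi M (h t) j 0).
Proof.
move=> mh j; split.
  under eq_fun do rewrite mxE /fourier_fun.
  case: (odd j.+1); apply: measurable_funM => //.
  - apply: (@measurableT_comp _ _ _ _ _ _ (@sin R)).
      by apply: continuous_measurable_fun; exact: continuous_sin.
    exact: measurable_funM.
  - apply: (@measurableT_comp _ _ _ _ _ _ (@cos R)).
      by apply: continuous_measurable_fun; exact: continuous_cos.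
    exact: measurable_funM.
exists (Num.sqrt 2) => t; rewrite mxE /fourier_fun; case: ifP => _;
  by rewrite normrM ger0_norm ?sqrtr_ge0// ler_piMr ?sqrtr_ge0 ?sin_max ?cos_max.
Qed.

Lemma fourier_series_inH (M : nat) (a : 'M[R]_(2, M)) : inH (fourier_series a).
Proof. by apply: tame_inH; apply/tame_mulmx/tame_psi. Qed.

Lemma residual_inH (M : nat) (u alpha : 'M[R]_(2, M)) (theta delta : R) :
  inH (fun t => rot theta *m fourier_series u (gamma delta t)
                - fourier_series alpha t).
Proof.
apply: tame_inH => i.
have [m1 [B1 b1]] : tame (fun t =>
    (rot theta *m fourier_series u (gamma delta t)) i 0).
  by apply/tame_mulmx/tame_mulmx/tame_psi.
have [m2 [B2 b2]] : tame (fun t => fourier_series alpha t i 0).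
  by apply/tame_mulmx/tame_psi.
have E t : (rot theta *m fourier_series u (gamma delta t)
    - fourier_series alpha t) i 0 =
    (rot theta *m fourier_series u (gamma delta t)) i 0
    - fourier_series alpha t i 0 by rewrite mxE [in X in _ + X]mxE.
split; first by under eq_fun do rewrite E; exact: measurable_funB.
exists (B1 + B2) => t; rewrite E.
exact: le_trans (ler_normB _ _) (lerD (b1 t) (b2 t)).
Qed.

End Membership.

(* Main.v *)
(* Shifting the argument of the pair (sin (w t), cos (w t)) by delta rotates the
   pair by w delta, so psi \o gamma delta = beta delta *m psi; the floor in gamma
   is harmless because every frequency is an integer.  The residual in H is thus
   the Fourier series with coefficient matrix O_theta u beta(delta) - alpha, and
   Parseval turns its H-norm into a Frobenius norm.  As beta has period 1,
   beta(delta) = beta(-(1 - delta)), which is the objective of the second problem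
   at (theta, 1 - delta).  Minimisers exist by compactness. *)

Require Import Defs.
From mathcomp Require Import all_boot all_order all_algebra.
From mathcomp Require Import all_classical all_reals all_analysis.
From mathcomp Require Import ring lra zify.
Import Order.TTheory GRing.Theory Num.Theory numFieldNormedType.Exports.

Set Implicit Arguments.
Unset Strict Implicit.
Unset Printing Implicit Defensive.

Local Open Scope classical_set_scope.
Local Open Scope ring_scope.

Lemma continuous_sum (R : realType) (T : topologicalType) (I : Type)
    (r : seq I) (f : I -> T -> R) :
  (forall i, continuous (f i)) -> continuous (fun t => \sum_(i <- r) f i t).
Proof.
move=> cf t; apply: (cvg_big (@add_continuous R^o)) => i _; exact: cf.
Qed.

(** * Periodicity of sine and cosine, and integrals of cosines of integer frequency *)

Section Trigonometry.
Variable R : realType.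
Implicit Types (c t x : R) (n : nat) (z : int).

(** The multiple is a signed integer because differences of frequencies and the floor in [gamma] may
    be negative. *)
Lemma cosDint x z : cos (x + 2 * pi * z%:~R) = cos x.
Proof.
have cosDn (n : nat) (y : R) : cos (y + 2 * pi * n%:R) = cos y.
  by rewrite mulr_natr mulr_natl periodicn//; exact: cosD2pi.
case: z => n; first exact: cosDn.
(* For a negative shift, adding [n.+1] periods leads back to [x]. *)
by rewrite NegzE intrN -[LHS](cosDn n.+1) mulrN subrK.
Qed.

Lemma sinDint x z : sin (x + 2 * pi * z%:~R) = sin x.
Proof. by rewrite -cosBpihalf addrAC cosDint cosBpihalf. Qed.

Lemma continuous_cos_affine (w c : R) : continuous (fun t => cos (w * t + c)).
Proof.
move=> t.
apply: (@continuous_comp _ _ _ (fun t => w * t + c)); last exact: continuous_cos.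
by apply: cvgD; [apply: cvgM; [exact: cvg_cst|exact: cvg_id]|exact: cvg_cst].
Qed.

(** For [z != 0] the antiderivative [sin (w * t + c) / w] takes equal values at 0 and 1, as [w] is a
    multiple of [2 * pi]. The free phase [c] lets one formula serve all products of sines and
    cosines. *)
Lemma integral_cos_int z c :
  \int[@lebesgue_measure R]_(t in @unit_interval R) cos (2 * pi * z%:~R * t + c)
  = if z == 0 then cos c else 0.
Proof.
set w := 2 * pi * z%:~R; case: eqP => [z0|/eqP z0].
  rewrite {}/w z0.
  under eq_Rintegral do rewrite mulr0 mul0r add0r.
  rewrite Rintegral_cst; last exact: measurable_itv.
  have := lebesgue_measure_itv (`[0, 1] : interval R).
  by rewrite /= lte_fin ltr01 sube0 => -> /=; rewrite mulr1.
have w0 : w != 0 by rewrite /w !mulf_neq0 ?pnatr_eq0 ?intr_eq0 ?(gt_eqF (pi_gt0 R)).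
pose F t := sin (w * t + c) / w.
have dF t : is_derive t 1 F (cos (w * t + c)).
  have dl : is_derive t 1 (fun t => w * t + c) w.
    by apply: is_derive_eq; rewrite /GRing.scale /=; ring.
  have ds := @is_derive1_comp R sin (fun t => w * t + c) t _ _ (is_derive_sin _) dl.
  rewrite (_ : F = fun t => w^-1 *: (sin \o (fun t => w * t + c)) t); last first.
    by apply/funext => s; rewrite /F mulrC.
  apply: is_derive_eq.
  by rewrite /GRing.scale /= mulrCA mulVf ?mulr1.
have cF : continuous F.
  by move=> t; apply/differentiable_continuous/derivable1_diffP.
rewrite /Rintegral (@continuous_FTC2 _ _ F) //.
- by rewrite -EFinB /F mulr1 mulr0 add0r [w + c]addrC /w sinDint subrr.
- exact/continuous_subspaceT/continuous_cos_affine.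
- split; first by move=> t _; exact: ex_derive.
  + by apply: cvg_at_right_filter; exact: cF.
  + by apply: cvg_at_left_filter; exact: cF.
- by move=> t _; rewrite derive1E derive_val.
Qed.

End Trigonometry.

(** * Orthonormality of the Fourier basis and Parseval's identity *)

Section Parseval.
Variable R : realType.
Implicit Types (t : R).

Local Notation integral01 f :=
  (\int[@lebesgue_measure R]_(t in @unit_interval R) f t).

Let continuous_integrable01 (f : R -> R) : continuous f ->
  (@lebesgue_measure R).-integrable (@unit_interval R) (EFin \o f).
Proof.
move=> cf; apply: continuous_compact_integrable; first exact: segment_compact.
exact: continuous_subspaceT.
Qed.

Lemma Rintegral_sum_continuous (I : Type) (r : seq I) (f : I -> R -> R) :
  (forall i, continuous (f i)) ->
  integral01 (fun t => \sum_(i <- r) f i t) = \sum_(i <- r) integral01 (f i).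
Proof.
move=> cf; elim: r => [|i r IH].
  under eq_Rintegral do rewrite big_nil.
  rewrite big_nil Rintegral_cst; last exact: measurable_itv.
  by rewrite mul0r.
under eq_Rintegral do rewrite big_cons.
rewrite RintegralD ?big_cons ?IH //; first exact: measurable_itv.
  exact: continuous_integrable01.
by apply: continuous_integrable01; exact: continuous_sum.
Qed.

(* Sines are phase-shifted cosines, so orthonormality reduces to the single
   integral of [integral_cos_int]. *)
Definition fourier_phase (k : nat) : R := if odd k then pi / 2 else 0.

(** The functions numbered 2b+1 and 2b+2 share the frequency b+1, which is [uphalf k]. *)
Lemma fourier_funE k t :
  fourier_fun k t = Num.sqrt 2 * cos (2 * pi * (uphalf k)%:R * t - fourier_phase k).
Proof.
rewrite /fourier_fun /fourier_phase uphalfE; case: ifPn => ok.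
  rewrite cosBpihalf; congr (_ * sin (_ * _)).
  rewrite [in LHS](_ : k.+1 = (k.+1)./2.*2); last by lia.
  by rewrite -muln2 natrM; ring.
rewrite subr0; congr (_ * cos (_ * _)).
rewrite [in LHS](_ : k = (k.+1)./2.*2); last by lia.
by rewrite -muln2 natrM; ring.
Qed.

Lemma continuous_fourier_fun k : continuous (@fourier_fun R k).
Proof.
rewrite (_ : fourier_fun k = fun t =>
  Num.sqrt 2 * cos (2 * pi * (uphalf k)%:R * t - fourier_phase k)); last first.
  by apply/funext => t; exact: fourier_funE.
by move=> t; apply: cvgM; [exact: cvg_cst|exact: continuous_cos_affine].
Qed.

(** Product-to-sum: 2 cos a cos b = cos (a - b) + cos (a + b), so only a vanishing difference or sum
    of frequencies can contribute to the integral. *)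
Lemma fourier_orthonormal (k l : nat) : (0 < k)%N -> (0 < l)%N ->
  integral01 (fun t => fourier_fun k t * fourier_fun l t) = (k == l)%:R.
Proof.
move=> k0 l0; pose p := uphalf k; pose q := uphalf l.
pose f (z : int) c t : R := cos (2 * pi * z%:~R * t + c).
have cf z c : continuous (f z c) by exact: continuous_cos_affine.
have E t : fourier_fun k t * fourier_fun l t =
  f (p%:Z - q%:Z) (fourier_phase l - fourier_phase k) t +
  f (p%:Z + q%:Z) (- (fourier_phase l + fourier_phase k)) t.
  rewrite !fourier_funE mulrACA -expr2 sqr_sqrtr ?ler0n// /f -/p -/q.
  rewrite intrB intrD.
  set a := 2 * pi * p%:R * t - _; set b := 2 * pi * q%:R * t - _.
  rewrite (_ : _ * t + (fourier_phase l - fourier_phase k) = a - b);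
    last by rewrite /a /b; ring.
  rewrite [in X in _ + X](_ : _ + _ = a + b); last by rewrite /a /b; ring.
  by clearbody a b; rewrite cosB cosD; ring.
under eq_Rintegral do rewrite E.
rewrite RintegralD; [|exact: measurable_itv|exact: continuous_integrable01..].
rewrite !integral_cos_int.
(* Positive indices have frequency at least 1, so the sum term integrates to zero. *)
have -> : (p%:Z + q%:Z == 0) = false by rewrite /p /q; lia.
rewrite addr0 subr_eq0 eqz_nat /p /q /fourier_phase.
case: (eqVneq k l) => [->|kl]; first by rewrite eqxx subrr cos0.
case: eqP => // pq.
(* Distinct indices of equal frequency have opposite parity: they are a sine and a cosine, whose
   phases differ by [pi / 2]. *)
have [ok|ok] := boolP (odd k); have [ol|ol] := boolP (odd l); try by exfalso; lia.
  by rewrite sub0r cosN cos_pihalf.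
by rewrite subr0 cos_pihalf.
Qed.

Lemma dotH_fourier_series (M : nat) (a : 'M[R]_(2, M)) :
  dotH (fourier_series a) (fourier_series a) = \sum_i \sum_j a i j ^+ 2.
Proof.
(* Indexing the expanded square by triples allows a single exchange of sum and integral;
   orthonormality then keeps only the diagonal. *)
pose f (s : 'I_2 * ('I_M * 'I_M)) t : R :=
  a s.1 s.2.1 * a s.1 s.2.2 * (fourier_fun s.2.1.+1 t * fourier_fun s.2.2.+1 t).
have cff (k l : nat) : continuous (fun t : R => fourier_fun k t * fourier_fun l t).
  by move=> t; apply: cvgM; exact: continuous_fourier_fun.
have E t : fourier_series a t 0 0 * fourier_series a t 0 0 +
           fourier_series a t 1 0 * fourier_series a t 1 0 = \sum_s f s t.
  rewrite -(pair_bigA _ (fun i jl => f (i, jl) t)) /=.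
  under eq_bigr => i _ do rewrite -(pair_bigA _ (fun j l => f (i, (j, l)) t)) /=.
  rewrite !big_ord_recl big_ord0 addr0 !mxE.
  have -> : 1 = lift ord0 ord0 :> 'I_2 by exact: val_inj.
  by congr (_ + _); rewrite big_distrlr; apply: eq_bigr => j _;
    apply: eq_bigr => l _; rewrite !mxE /f /= mulrACA.
rewrite /dotH; under eq_Rintegral do rewrite E.
rewrite [LHS]Rintegral_sum_continuous; last first.
  by move=> s t; apply: cvgM; [exact: cvg_cst|exact: cff].
rewrite -(pair_bigA _ (fun i jl => integral01 (f (i, jl)))) /=.
apply: eq_bigr => i _.
rewrite -(pair_bigA _ (fun j l => integral01 (f (i, (j, l))))) /=.
have fE j l : integral01 (f (i, (j, l))) = a i j * a i l * (j == l)%:R.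
  rewrite /f /= RintegralZl; [|exact: measurable_itv|].
    by congr (_ * _); rewrite [LHS]fourier_orthonormal.
  exact/continuous_integrable01/cff.
apply: eq_bigr => j _; rewrite (bigD1 j) //= fE eqxx mulr1 -expr2.
by rewrite big1 ?addr0// => l lj; rewrite fE eq_sym (negPf lj) mulr0.
Qed.

Lemma normH_fourier_series (M : nat) (a : 'M[R]_(2, M)) :
  normH (fourier_series a) = frobenius a.
Proof. by rewrite /normH dotH_fourier_series. Qed.

End Parseval.

(** * The circular shift as multiplication by [beta] *)

Section Shift.
Variables (R : realType) (M : nat).

Lemma betaE (s : R) (i j : 'I_M) : beta M s i j =
  let w := 2 * pi * (i./2).+1%:R * s in
  if i./2 == j./2 then
    if odd i == odd j then cos w else if odd j then - sin w else sin w
  else 0.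
Proof.
rewrite mxE /=; case: ifP => // _; rewrite /Defs.rot mxE.
rewrite (_ : _%:R * pi * s = 2 * pi * (i./2).+1%:R * s); last first.
  by rewrite -muln2 natrM; ring.
rewrite -!val_eqE /= !inordK ?ltnS ?leq_b1//.
by case: (odd i); case: (odd j).
Qed.

(** Every block angle changes by an integer multiple of [2 * pi]. *)
Lemma beta_periodic (s : R) : beta M (s - 1) = beta M s.
Proof.
apply/matrixP => i j; rewrite !betaE /=.
set w := 2 * pi * _ * s.
have -> : 2 * pi * (i./2).+1%:R * (s - 1) = w + 2 * pi * (- (i./2).+1%:Z)%:~R.
  by rewrite intrN /w; ring.
by rewrite cosDint sinDint.
Qed.

Lemma psi_gamma (delta t : R) : ~~ odd M ->
  psi M (gamma delta t) = beta M delta *m psi M t.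
Proof.
move=> M_even; apply/colP => i; rewrite [RHS]mxE.
(* Evenness of [M] enters here: an even [i] is never the last index, so its block is complete. *)
have i'M : ((if odd i then i.-1 else i.+1) < M)%N.
  by have := ltn_ord i; case: ifP => oi; lia.
(* [i'] is the other row of the 2 x 2 block containing row [i]. *)
pose i' := Ordinal i'M.
have i'i : i' != i by rewrite -val_eqE /=; case: ifP => oi; lia.
rewrite (bigD1 i) //= (bigD1 i') //= [X in _ + (_ + X)]big1 ?addr0; last first.
  move=> j /andP[ji ji']; rewrite betaE /=; case: eqP; rewrite ?mul0r// => E.
  by move: ji ji'; rewrite -!val_eqE /=; case: ifP => oi; lia.
rewrite !betaE /= !eqxx.
have -> : (i./2 == (if odd i then i.-1 else i.+1)./2) = true.
  by case: ifP => oi; lia.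
have i'_odd : odd (if odd i then i.-1 else i.+1) = ~~ odd i.
  by case: ifP => oi; lia.
rewrite i'_odd !mxE /=.
pose n := Num.floor (t - delta).
pose z : R := 2 * pi * (i./2).+1%:R.
(* Both rows of a block have angular frequency [z]. Counting from 0 swaps the parities: even [m]
   carries the sine, odd [m] the cosine. *)
have sE (x : R) (m : nat) : m./2 = i./2 -> fourier_fun m.+1 x =
    if odd m then Num.sqrt 2 * cos (z * x) else Num.sqrt 2 * sin (z * x).
  move=> mi; rewrite /fourier_fun /= if_neg; case: ifP => om.
    rewrite (_ : m.+1 = (i./2).+1.*2); last by lia.
    by rewrite -muln2 natrM /z; congr (_ * cos _); ring.
  rewrite (_ : m.+2 = (i./2).+1.*2); last by lia.
  by rewrite -muln2 natrM /z; congr (_ * sin _); ring.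
have gE : z * gamma delta t = z * t - z * delta + 2 * pi * (- (i./2).+1%:Z * n)%:~R.
  by rewrite /gamma -/n intrM intrN /z; ring.
rewrite !sE //=; last by case: ifP => oi; lia.
rewrite i'_odd gE cosDint sinDint cosB sinB -/z.
by case: (odd i) => /=; ring.
Qed.

Lemma objH_fourier_series (u alpha : 'M[R]_(2, M)) (p : R * R) :
  ~~ odd M ->
  objH (fourier_series u) (fourier_series alpha) p =
  objF u alpha (reverse_shift p).
Proof.
(* The reversed shift gives [beta M (delta - 1)], which periodicity turns into [beta M delta]. *)
move=> M_even; rewrite /objH /objF /= opprB beta_periodic -normH_fourier_series.
congr (normH _ ^+ 2); apply/funext => t.
by rewrite /fourier_series psi_gamma// mulmxBl !mulmxA.
Qed.

End Shift.

(** * Continuity of the matrix objective and existence of minimisers *)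

Section Existence.
Variable R : realType.

(** Entrywise continuity reduces everything to limits of real-valued functions. *)
Let mx_continuous (m n : nat) (A : R * R -> 'M[R]_(m, n)) :=
  forall i j, continuous (fun p => A p i j).

Let mx_continuousM (m n k : nat) (A : R * R -> 'M[R]_(m, n))
    (B : R * R -> 'M[R]_(n, k)) :
  mx_continuous A -> mx_continuous B -> mx_continuous (fun p => A p *m B p).
Proof.
move=> cA cB i j; under eq_fun do rewrite mxE.
by apply: continuous_sum => l p; apply: cvgM; [exact: cA|exact: cB].
Qed.

Lemma objF_continuous (M : nat) (u alpha : 'M[R]_(2, M)) :
  continuous (objF u alpha).
Proof.
have c_rot i j : continuous (fun x => @Defs.rot R x i j).
  under eq_fun do rewrite mxE.
  move=> x; case: ifP => _; first exact: continuous_cos.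
  by case: ifP => _; [apply: cvgN|]; exact: continuous_sin.
have c_rot1 : mx_continuous (fun p => Defs.rot p.1).
  by move=> i j p; apply: (@continuous_comp _ _ _ fst (fun x => Defs.rot x i j));
    [exact: cvg_fst|exact: c_rot].
have c_beta : mx_continuous (fun p => beta M (- p.2)).
  move=> i j; under eq_fun do rewrite mxE.
  move=> p; case: ifP => _; last exact: cvg_cst.
  apply: (@continuous_comp _ _ _ (fun p : R * R => (i./2).+1.*2%:R * pi * - p.2)
    (fun x => Defs.rot x (inord (odd i)) (inord (odd j)))); last exact: c_rot.
  by apply: cvgM; [exact: cvg_cst|apply: cvgN; exact: cvg_snd].
have cA : mx_continuous (fun p => Defs.rot p.1 *m u *m beta M (- p.2) - alpha).
  move=> i j; under eq_fun do rewrite mxE [X in _ + X]mxE.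
  move=> p; apply: cvgB; last exact: cvg_cst.
  apply: mx_continuousM => //; apply: mx_continuousM => // i' j' q; exact: cvg_cst.
(* Squaring the norm removes the root, leaving a sum of squares of continuous entries. *)
rewrite (_ : objF u alpha = fun p =>
  \sum_i \sum_j (Defs.rot p.1 *m u *m beta M (- p.2) - alpha) i j ^+ 2); last first.
  apply/funext => p; rewrite /objF /frobenius sqr_sqrtr//.
  by apply: sumr_ge0 => i _; apply: sumr_ge0 => j _; exact: sqr_ge0.
by do 2!apply: continuous_sum => ?; move=> p; apply: cvgM; exact: cA.
Qed.

Lemma argmin_objF_neq0 (M : nat) (u alpha : 'M[R]_(2, M)) :
  argmin (@feasible R) (objF u alpha) !=set0.
Proof.
have [|||p /set_mem Dp pmin] :=
    @compact_EVT_min _ R (objF u alpha) (@feasible R).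
- exists (0, 0); split; rewrite /unit_interval /= in_itv /= lexx ?ler01//.
  by rewrite mulr_ge0// pi_ge0.
- by apply: compact_setX; exact: segment_compact.
- exact/continuous_subspaceT/objF_continuous.
by exists p; split => // y Dy; apply: pmin; exact: mem_set.
Qed.

End Existence.

(** * Equivalence of the two problems through an involution *)

(** As [h] is its own inverse, [f = g \o h] also gives [g = f \o h], so [h] carries minimisers both
    ways, and one minimiser of [g] yields the common minimum. *)
Lemma equivalent_via_involution (R : realType) (T : Type) (D : set T)
    (h : T -> T) (f g : T -> R) :
  involutive h -> (forall x, D x -> D (h x)) -> (forall x, f x = g (h x)) ->
  argmin D g !=set0 -> equivalent_via D h f g.
Proof.
move=> hK hD fg [x0 [Dx0 x0min]].
have gf x : g x = f (h x) by rewrite fg hK.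
have hmin x : argmin D g x -> argmin D f (h x).
  by move=> [Dx xm]; split => [|y Dy]; [exact: hD|rewrite !fg hK; exact/xm/hD].
have hmin' x : argmin D f x -> argmin D g (h x).
  by move=> [Dx xm]; split => [|y Dy]; [exact: hD|rewrite !gf hK; exact/xm/hD].
split => //.
- split => //.
  + by move=> x y _ _; exact: inv_inj.
  + by move=> y Dy; exists (h y); [exact: hD|exact: hK].
- apply/seteqP; split=> [_ [x xm <-]|y ym]; first exact: hmin'.
  by exists (h y); [exact: hmin|exact: hK].
- exists (g x0); split; last by exists x0.
  by exists (h x0); [exact: hmin|rewrite gf].
Qed.

Theorem proposition2p3 (R : realType) (M : nat) (M_ge2 : (2 <= M)%N)
  (M_even : ~~ odd M) (u alpha : 'M[R]_(2, M))
  (mu_unit : normH (fourier_series u) = 1%R)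
  (C_unit : normH (fourier_series alpha) = 1%R) :
  equivalent_via (@feasible R) (@reverse_shift R)
    (objH (fourier_series u) (fourier_series alpha)) (objF u alpha).
Proof.
apply: equivalent_via_involution.
- by move=> [theta delta]; rewrite /reverse_shift /= subKr.
- move=> [theta delta] [/= Dt]; rewrite /unit_interval /= in_itv /= => d01.
  by split; rewrite /unit_interval //= in_itv /=; lra.
- by move=> p; exact: objH_fourier_series.
- exact: argmin_objF_neq0.
Qed.
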